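(* (i) Let $p>3$ be a prime, and let $t=v/u\in\mathbb Q$ with $u,v\in\mathbb Z$, $p\nmid u$. Then $$\prod_{\substack{0<i<j<p/2\\ p\nmid i^2-ij+tj^2}}\Big(\frac{i^2-ij+tj^2}{p}\Big)=\begin{cases}-1 & \text{if } p\equiv 5,7\pmod 8 \text{ and } \big(\frac{4t-1}{p}\big)=-1,\\ 1 & \text{otherwise}.\end{cases}$$ (ii) Fix a nonzero $s\in\mathbb Z$ and let $p$ range over primes $p>3$ with $p\nmid s$. Then both $p\mapsto F_p(0,1,s^2)\bmod 16$ and $p\mapsto \prod_{0<i<j<p/2,\ p\nmid s^2i^2-j^2}\big(\frac{s^2i^2-j^2}{p}\big)$ are periodic functions of $p$.
   Context: $\big(\frac{\cdot}{p}\big)$ is the Legendre symbol; for a rational number $x$ whose denominator is prime to $p$, congruences and $\big(\frac{x}{p}\big)$ are understood by replacing $x$ with an integer congruent to it modulo $p$ (so $p\mid x$ and $\big(\frac{x}{p}\big)$ make sense). Products are over integers $i,j$. $F_p(0,1,n)=\sum_{y=1}^{p}\big(\frac{y(y+1)(y+n)}{p}\big)$, and ''$\bmod 16$'' denotes the least nonnegative residue modulo $16$. A function $g$ on a set of primes is periodic if there is $m\in\mathbb Z_{>0}$ with $g(p_1)=g(p_2)$ whenever $p_1\equiv p_2\pmod m$ lie in its domain. *)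

(* Defs.v *)
From mathcomp Require Import all_boot all_order all_algebra.

Set Implicit Arguments.
Unset Strict Implicit.
Unset Printing Implicit Defensive.

Import Order.TTheory GRing.Theory Num.Theory.
Local Open Scope ring_scope.

(* Intended for p an odd prime. *)
Definition legendre (p : nat) (a : int) : int :=
  if (p %| a)%Z then 0
  else if [exists x : 'I_p, (x%:Z ^+ 2 == a %[mod p])%Z] then 1 else -1.

(* The representative in [0, p) of a rational x modulo p, where x = r (mod p)
   means that p divides the numerator of x - r in lowest terms. It exists, and
   is unique, when p is prime and does not divide the denominator of x (see
   ratmodP and ratmod_uniq); the value 0 is junk otherwise. *)
Definition ratmod (p : nat) (x : rat) : int :=
  if [pick r : 'I_p | (p %| numq (x - (r%:Z)%:Q))%Z] is Some r then r%:Z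
  else 0.

Definition dvdq (p : nat) (x : rat) : bool := (p %| ratmod p x)%Z.

Definition legendreq (p : nat) (x : rat) : int := legendre p (ratmod p x).

(* F_p(0, 1, n) *)
Definition F01 (p : nat) (n : int) : int :=
  \sum_(1 <= y < p.+1) legendre p (y%:Z * (y%:Z + 1) * (y%:Z + n)).

Definition periodic_on (D : pred nat) (g : nat -> int) : Prop :=
  exists2 m : nat, (0 < m)%N &
    forall p1 p2 : nat, D p1 -> D p2 -> p1 = p2 %[mod m] -> g p1 = g p2.

Lemma numq_subz_dvd (p : nat) (x : rat) (a : int) :
    prime p -> ~~ (p %| denq x)%Z ->
  (p %| numq (x - a%:Q))%Z = (p %| numq x - a * denq x)%Z.
Proof.
move=> pp ndx; set y := x - a%:Q.
have E : numq y * denq x = (numq x - a * denq x) * denq y.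
  apply: (@intr_inj rat); rewrite !rmorphM rmorphB rmorphM /= !numqE.
  by rewrite -mulrBl -/y mulrAC.
have cop (z : rat) : ~~ (p %| denq z)%Z -> coprimez p (denq z).
  by move=> nz; rewrite /coprimez -[(_ == _)]/(coprime p `|denq z|%N) prime_coprime.
apply/idP/idP => h.
  have h1 : (p %| (numq x - a * denq x) * denq y)%Z by rewrite -E dvdz_mulr.
  suff cy : coprimez p (denq y) by rewrite Gauss_dvdzl in h1.
  apply: cop; apply: contraL h => hd; apply/negP => hn.
  have : (p %| gcdn `|numq y| `|denq y|)%N by rewrite dvdn_gcd [X in X && _]hn.
  by rewrite (eqP (coprime_num_den y)) dvdn1; case: eqP pp => // ->.
by rewrite -(Gauss_dvdzl _ (cop _ ndx)) E dvdz_mulr.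
Qed.

Lemma ratmod_uniq (p : nat) (x : rat) (a b : int) :
    prime p -> ~~ (p %| denq x)%Z ->
    (p %| numq (x - a%:Q))%Z -> (p %| numq (x - b%:Q))%Z ->
  (a = b %[mod p])%Z.
Proof.
move=> pp ndx; rewrite !numq_subz_dvd // => ha hb; apply/eqP.
have cx : coprimez p (denq x).
  by rewrite /coprimez -[(_ == _)]/(coprime p `|denq x|%N) prime_coprime.
rewrite eqz_mod_dvd -(Gauss_dvdzl _ cx) mulrBl.
have -> : a * denq x - b * denq x
        = (numq x - b * denq x) - (numq x - a * denq x).
  by rewrite opprB [RHS]addrC addrA subrK.
exact: rpredB.
Qed.

Lemma ratmodP (p : nat) (x : rat) : prime p -> ~~ (p %| denq x)%Z ->
  (p %| numq (x - (ratmod p x)%:Q))%Z.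
Proof.
move=> pp ndx; rewrite /ratmod; case: pickP => //= none.
have p0 : (p : int) != 0 by rewrite -lt0n prime_gt0.
have cx : coprimez p (denq x).
  by rewrite /coprimez -[(_ == _)]/(coprime p `|denq x|%N) prime_coprime.
have [[u v] /= uv] := coprimezP _ _ cx.
have rge := modz_ge0 (numq x * v) p0.
have rlt : (`|(numq x * v %% p)%Z| < p)%N.
  by rewrite -ltz_nat gez0_abs // ltz_pmod // ltz_nat prime_gt0.
have := none (Ordinal rlt); rewrite /= gez0_abs // numq_subz_dvd // => /negP[].
have -> : numq x - (numq x * v %% p)%Z * denq x
   = (numq x * u + (numq x * v %/ p)%Z * denq x) * p.
  have := divz_eq (numq x * v) p; move/eqP; rewrite addrC -subr_eq => /eqP <-.
  rewrite mulrBl mulrDl opprB addrCA [RHS]addrC mulrAC; congr (_ + _).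
  by rewrite -{1}[numq x]mulr1 -uv mulrDr !mulrA addrK.
exact: dvdz_mull.
Qed.

(* Main.v *)
(* In (i), q(j - i, j) = q(i, j), so the factors with fixed j cancel in pairs
   except at j = 2i, where q = (4t - 1) i^2; there are floor(p/4) of those.

   In (ii), write chi for the quadratic character. Expanding
   (1 + chi u)(1 + chi(u+1))(1 + chi(u+s^2)) and summing over u expresses F_p as
   8N plus values of chi at constants, where N counts the u at which all three
   characters are 1. The involution u -> s^2/u preserves that set and fixes only
   u = s and u = -s, so F_p mod 16 depends only on p mod 16 and on the symbols of
   -1, s, s+1, s-1; these are periodic in p by Gauss's lemma.

   For the product, (i, j) -> (j - i, +-(i + j)) permutes the pairs
   0 < i < j < p/2 and turns s^2 i^2 - j^2 into i^2 Q(-j/i), where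
   Q(r) = (s^2 - 1)(r^2 + 1) + 2(s^2 + 1) r is self-reciprocal. Hence pairs can be
   grouped by the ratio {r, 1/r}; the number of pairs with given ratio has its
   parity given by Gauss's lemma, and the product becomes (-1)^N, where 2N is, modulo 4
   and up to a correction at r = -1, the number of r with chi r = chi(Q r) = -1. That
   number is computed by the sum of chi(r Q(r)), which is chi(-1) F_p because the two
   cubics are 2-isogenous. *)
Require Import Defs.
From mathcomp Require Import all_boot all_order all_algebra.
From mathcomp Require Import all_fingroup all_solvable all_field.
From mathcomp Require Import zify ring.

Set Implicit Arguments.
Unset Strict Implicit.
Unset Printing Implicit Defensive.

Import Order.TTheory GRing.Theory Num.Theory.
Local Open Scope ring_scope.

(** * Cancellation along an involution *)

Lemma big_involution (R : Type) (idx : R) (op : Monoid.com_law idx)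
    (T : finType) (A : pred T) (h : T -> T) (e : T -> R) :
  {in A, forall x, A (h x)} -> {in A, forall x, h (h x) = x} ->
  {in A, forall x, e (h x) = e x} ->
  exists B : pred T, \big[op/idx]_(x | A x) e x =
    op (\big[op/idx]_(x | A x && (h x == x)) e x)
       (op (\big[op/idx]_(x | B x) e x) (\big[op/idx]_(x | B x) e x)).
Proof.
(* [B] keeps, from each two-element orbit, the member of smaller rank; [h] carries it onto the
   remaining non-fixed points, hence the repeated factor. *)
move=> hA hK he; pose B x := A x && (enum_rank x < enum_rank (h x))%N.
exists B.
rewrite (bigID (fun x => h x == x)) /=; congr (op _ _).
rewrite (bigID (fun x => enum_rank x < enum_rank (h x))%N) /=; congr (op _ _).
  apply: eq_bigl => x; rewrite /B; case: (A x) => //=.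
  by case: eqP => //= ->; rewrite ltnn.
rewrite [RHS](reindex_onto h h) => [|x /andP[Ax _]]; last exact: hK.
apply: eq_big => [x|x /andP[/andP[Ax _] _]]; last by rewrite he.
rewrite /B; case Ax: (A x) => /=; last first.
  by apply/esym/negP => /andP[/andP[Ahx _] /eqP hhx]; have := hA _ Ahx; rewrite hhx Ax.
rewrite hA // hK // eqxx andbT /= -leqNgt ltn_neqAle.
by rewrite (inj_eq val_inj) (inj_eq enum_rank_inj).
Qed.

Lemma sum_involution (T : finType) (A : pred T) (h : T -> T) (e : T -> nat) :
  {in A, forall x, A (h x)} -> {in A, forall x, h (h x) = x} ->
  {in A, forall x, e (h x) = e x} ->
  exists m, (\sum_(x | A x) e x = \sum_(x | A x && (h x == x)) e x + m.*2)%N.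
Proof.
move=> hA hK he; have [B /= ->] := big_involution addn hA hK he.
by exists (\sum_(x | B x) e x)%N; rewrite -addnn.
Qed.

Lemma prod_involution (T : finType) (A : pred T) (h : T -> T) (e : T -> int) :
  {in A, forall x, A (h x)} -> {in A, forall x, h (h x) = x} ->
  {in A, forall x, e (h x) = e x} -> (forall x, e x ^+ 2 = 1) ->
  \prod_(x | A x) e x = \prod_(x | A x && (h x == x)) e x.
Proof.
move=> hA hK he e2; have [B /= ->] := big_involution *%R hA hK he.
by rewrite -expr2 -prodrXl [X in _ * X]big1 ?mulr1.
Qed.

(** * The quadratic character of a finite field of odd order *)

Section QuadraticCharacter.

Variable F : finFieldType.
Hypothesis oddF : odd #|F|.
Implicit Types x y z a b c d : F.

(** Euler's criterion serves as definition, so that multiplicativity is inherited from powers; the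
    link with squares is [euler]. *)
Definition chi x : int :=
  if x == 0 then 0 else if x ^+ #|F|./2 == 1 then 1 else -1.


(** In characteristic 2, x -> x + 1 would be an involution without fixed points, making the order of
    F even. *)
Lemma two_neq0 : (2%:R : F) != 0.
Proof.
apply/eqP => F2; have addxx x : x + x = 0 by rewrite -mulr2n -mulr_natr F2 mulr0.
have [||//|m] := @sum_involution F predT (fun x => x + 1) (fun=> 1%N).
- by [].
- by move=> x _; rewrite -addrA addxx addr0.
rewrite sum1_card big_pred0 => [/(congr1 odd)|x /=].
  by rewrite add0n odd_double oddF.
by rewrite -{2}[x]addr0 (inj_eq (addrI x)) oner_eq0.
Qed.

Lemma one_neq_neg1 : (1 : F) != -1.
Proof. by rewrite -subr_eq0 opprK -mulr2n two_neq0. Qed.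

Lemma eq_opp_neq0 x : x != 0 -> (x == - x) = false.
Proof.
by move=> x0; rewrite -addr_eq0 -mulr2n -mulr_natr mulf_eq0 (negPf x0) (negPf two_neq0).
Qed.

Lemma double_halfF : (#|F|./2).*2.+1 = #|F|.
Proof. by rewrite -[RHS](odd_double_half #|F|) oddF. Qed.

Lemma expf_half_sqr x : x != 0 -> (x ^+ #|F|./2) ^+ 2 = 1.
Proof.
move=> x0; rewrite -exprM muln2; apply: (mulIf x0).
by rewrite mul1r -exprSr double_halfF expf_card.
Qed.

Lemma expf_half x : x != 0 -> {x ^+ #|F|./2 = 1} + {x ^+ #|F|./2 = -1}.
Proof.
move/expf_half_sqr/eqP; rewrite sqrf_eq1.
by case: eqP => [|_ /eqP]; [left | right].
Qed.

Lemma chiE x : (chi x)%:~R = x ^+ #|F|./2.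
Proof.
rewrite /chi; have [->|x0] := eqVneq x 0.
  by rewrite expr0n; have := finNzRing_gt1 F; case: #|F| => [|[|]].
by case: (expf_half x0) => ->; rewrite ?eqxx // eq_sym (negPf one_neq_neg1).
Qed.

Lemma chi0 : chi 0 = 0. Proof. by rewrite /chi eqxx. Qed.

Lemma chi1 : chi 1 = 1. Proof. by rewrite /chi oner_eq0 expr1n eqxx. Qed.

Lemma chi_pm1 x : x != 0 -> {chi x = 1} + {chi x = -1}.
Proof. by rewrite /chi => /negPf ->; case: eqP; [left | right]. Qed.

(** Since 1 and -1 differ in F, the integers 0, 1, -1 stay distinct there; this lifts identities
    between powers in F to identities between symbols. *)
Lemma chi_inj x (e : int) : e \in [:: 0; 1; -1] -> e%:~R = x ^+ #|F|./2 ->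
  chi x = e.
Proof.
rewrite -chiE !inE; have n1 := negPf one_neq_neg1.
have [->|/[dup] x0 /chi_pm1[] ->] := eqVneq x 0; rewrite ?chi0.
- by case/or3P => /eqP -> //= /eqP; rewrite ?mulrN1z ?oppr_eq0 oner_eq0.
- case/or3P => /eqP -> //= /eqP; rewrite ?mulrN1z 1?eq_sym ?oner_eq0 //.
  by rewrite n1.
- case/or3P => /eqP -> //= /eqP; rewrite ?mulrN1z ?n1 // eq_sym oppr_eq0.
  by rewrite oner_eq0.
Qed.

Lemma chi_in x : chi x \in [:: 0; 1; -1].
Proof. by rewrite /chi; case: ifP => // _; case: ifP. Qed.

Lemma chiM : {morph chi : x y / x * y}.
Proof.
move=> x y; apply: chi_inj; last by rewrite rmorphM /= !chiE exprMn.
by have := chi_in x; have := chi_in y; rewrite !inE => /or3P[] /eqP -> /or3P[] /eqP ->.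
Qed.

Lemma chi_sqr x : x != 0 -> chi x ^+ 2 = 1.
Proof. by case/chi_pm1 => ->. Qed.

Lemma chiX2 x : x != 0 -> chi (x ^+ 2) = 1.
Proof. by rewrite expr2 chiM -expr2; apply: chi_sqr. Qed.

Lemma chiV x : chi x^-1 = chi x.
Proof.
have [->|x0] := eqVneq x 0; first by rewrite invr0.
by rewrite -[LHS]mulr1 -(chi_sqr x0) expr2 mulrA -chiM mulVf // chi1 mul1r.
Qed.

Lemma chiMX2 x y : y != 0 -> chi (x * y ^+ 2) = chi x.
Proof. by move=> y0; rewrite chiM chiX2 ?mulr1. Qed.

(** The unit group is cyclic of order 2h with h = [#|F|./2]. If x = g^k for a generator g, then x^h
    = 1 forces 2h to divide kh, so k is even. *)
Lemma euler x : chi x = 1 -> exists y, x = y ^+ 2.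
Proof.
move=> x1; have x0 : x != 0 by apply: contra_eqN x1 => /eqP ->; rewrite chi0.
have [g gP] := cyclicP (field_unit_group_cyclic [set: {unit F}]%G).
have ux : x \is a GRing.unit by rewrite unitfE.
have : FinRing.unit F ux \in <[g]>%g by rewrite -gP inE.
case/cycleP => k kP.
have ng : #[g]%g = (#|F|./2.*2)%N.
  by rewrite orderE -gP card_finField_unit -[in LHS]double_halfF.
have : (FinRing.unit F ux ^+ #|F|./2)%g = 1%g.
  by apply: val_inj; rewrite FinRing.val_unitX /= -chiE x1.
rewrite kP -expgM => /eqP; rewrite -order_dvdn ng -muln2 mulnC.
rewrite dvdn_pmul2r ?half_gt0 ?finNzRing_gt1 // => /dvdnP[m mP].
exists (val (g ^+ m)%g).
by rewrite -FinRing.val_unitX -expgM -mP -kP.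
Qed.

(** * Complete character sums *)

Lemma card_sqrt d : (#|[pred y | y ^+ 2 == d]|%:R : int) = 1 + chi d.
Proof.
have [->|d0] := eqVneq d 0.
  rewrite chi0 (@eq_card1 _ 0) // => y; rewrite !inE sqrf_eq0 //.
case: (chi_pm1 d0) => [/[dup] d1 /euler[y yP]|d1]; rewrite d1.
  have y0 : y != 0 by apply: contraNneq d0 => y0; rewrite yP y0 expr0n.
  rewrite (@eq_card _ _ (pred2 y (- y))) ?card2 ?eq_opp_neq0 // => z.
  by rewrite !inE yP eqf_sqr.
rewrite eq_card0 // => y; rewrite !inE; apply/negP => /eqP yP.
have y0 : y != 0 by apply: contraNneq d0 => y0; rewrite -yP y0 expr0n.
by move: d1; rewrite -yP chiX2.
Qed.

(** The pairs (x, y) with y^2 = x are counted once by x and once by y. *)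
Lemma sum_chi : \sum_(x : F) chi x = 0.
Proof.
have : \sum_(x : F) (1 + chi x) = #|F|%:R.
  transitivity (\sum_(x : F) \sum_(y : F | y ^+ 2 == x) (1 : int)).
    by apply: eq_bigr => d _; rewrite -card_sqrt sumr_const.
  by rewrite (exchange_big_dep predT) //=; under eq_bigr => y _ do
    rewrite (big_pred1 (y ^+ 2)) 1?eq_sym //; rewrite sumr_const.
by rewrite big_split sumr_const /= -[RHS]addr0 => /addrI.
Qed.

(** After a translation and with c = b - a, the symbol of x (x + c) equals that of 1 + c/x for x
    nonzero, and 1 + c/x takes every value except 1. The full sum being 0, what remains is - chi
    1. *)
Lemma sum_chi_shift2 a b : a != b -> \sum_(x : F) chi ((x + a) * (x + b)) = -1.
Proof.
move=> ab; have c0 : b - a != 0 by rewrite subr_eq0 eq_sym.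
rewrite (reindex_inj (addIr (- a))) /=.
under eq_bigr => x _ do rewrite subrK -addrA [- a + b]addrC.
rewrite (bigD1 0) //= mul0r chi0 add0r.
pose h (y : F) := (b - a) / (y - 1).
have hK x : x != 0 -> 1 + (b - a) / x != 1.
  by move=> x0; rewrite -subr_eq0 addrAC subrr add0r mulf_neq0 ?invr_eq0.
have -> : \sum_(x | x != 0) chi (x * (x + (b - a))) = \sum_(y | y != 1) chi y.
  rewrite [RHS](reindex_onto (fun x => 1 + (b - a) / x) h) => [|y y1].
    apply: eq_big => x.
      have [->|x0] := eqVneq x 0; first by rewrite invr0 mulr0 addr0 eqxx.
      by rewrite hK //= /h [1 + _]addrC addrK invf_div mulrC divfK ?eqxx.
    by move=> x0; rewrite -[RHS](chiMX2 _ x0) mulrDl; congr chi; field.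
  by rewrite /h invf_div mulrC divfK // addrC subrK.
by have /eqP := sum_chi; rewrite (bigD1 1) //= chi1 addrC addr_eq0 => /eqP.
Qed.

Lemma big_fiber (e : F -> int) (h : F -> F) (P : pred F) :
  \sum_(x | P x) e (h x) = \sum_(w : F) #|[pred x | P x & h x == w]|%:R * e w.
Proof.
rewrite (partition_big h predT) //=; apply: eq_bigr => w _.
by rewrite (eq_bigr (fun=> e w)) => [|x /andP[_ /eqP ->//]]; rewrite sumr_const mulr_natl.
Qed.

(* The substitution w = x + b/x, which takes the value w for 1 + chi(w^2 - 4b)
   values of x. *)
Lemma sum_chi_isogeny a b : b != 0 ->
  \sum_(x : F) chi (x * (x ^+ 2 + a * x + b)) =
  \sum_(x : F) chi (x * (x ^+ 2 - 2%:R * a * x + (a ^+ 2 - 4%:R * b))).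
Proof.
move=> b0; rewrite (bigD1 0) //= mul0r chi0 add0r.
transitivity (\sum_(x | x != 0) chi (x + b / x + a)).
  apply: eq_bigr => x x0; rewrite -[RHS](chiMX2 _ x0); congr chi; field.
  exact: x0.
rewrite (big_fiber (fun w => chi (w + a)) (fun x => x + b / x) (fun x => x != 0)).
transitivity (\sum_(w : F) (1 + chi (w ^+ 2 - 4%:R * b)) * chi (w + a)).
  apply: eq_bigr => w _; congr (_ * _); rewrite -card_sqrt; congr _%:R.
  (* x -> 2x - w sends the roots of x^2 - w x + b to the square roots of the discriminant w^2 -
     4b. *)
  rewrite -(card_image (f := fun x => 2%:R * x - w)) => [|x y]; last first.
    by move/addIr/(mulfI two_neq0).
  apply: eq_card => y; rewrite inE; apply/imageP/eqP.
  - case=> x; rewrite inE => /andP[x0 /eqP <-] ->; field; exact: x0.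
  - move=> yP; exists ((y + w) / 2%:R); last by field; exact: two_neq0.
    have q : ((y + w) / 2%:R) * (w - (y + w) / 2%:R) = b.
      have -> : b = (w ^+ 2 - y ^+ 2) / 4%:R.
        rewrite yP; field; rewrite (natrM _ 2 2) mulf_neq0 ?two_neq0 //.
      by field; rewrite ?two_neq0 // (natrM _ 2 2) mulf_neq0 ?two_neq0.
    have x0 : (y + w) / 2%:R != 0 by apply: contraNneq b0 => x0; rewrite -q x0 mul0r.
    rewrite inE x0 /=; apply/eqP.
    by rewrite -q [_ * (w - _)]mulrC mulfK // addrC subrK.
rewrite (eq_bigr (fun w => chi (w + a) + chi ((w ^+ 2 - 4%:R * b) * (w + a)))); last first.
  by move=> w _; rewrite mulrDl mul1r -chiM.
have s0 : \sum_(w : F) chi (w + a) = 0 by rewrite -[RHS]sum_chi [RHS](reindex_inj (addIr a)).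
rewrite big_split /= s0 add0r.
rewrite (reindex_inj (addIr (- a))) /=; apply: eq_bigr => x _; congr chi; ring.
Qed.

(** * The cubic sum modulo 16, and the count attached to the isogenous cubic *)

Section CubicSum.

Variable s : F.
Hypotheses (s0 : s != 0) (sp1 : s + 1 != 0) (sm1 : s - 1 != 0).

Definition cubic_sum : int := \sum_(y : F) chi (y * (y + 1) * (y + s ^+ 2)).

Lemma chiN x : chi (- x) = chi (-1) * chi x.
Proof. by rewrite -chiM mulN1r. Qed.

Lemma sqr_sub1_neq0 : s ^+ 2 - 1 != 0.
Proof. by rewrite subr_sqr_1 mulf_neq0. Qed.

Definition square_triple u := [&& chi u == 1, chi (u + 1) == 1 & chi (u + s ^+ 2) == 1].

(** The product [f u] is 8 on the counted set and 0 off it, except at u = 0, -1, -s^2, where one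
    factor is 1 because its symbol vanishes. Those three values are the corrections; in the
    expansion the linear sums are 0 and the three quadratic ones are -1 each. *)
Lemma card_square_triple : 8 * #|square_triple|%:Z =
  #|F|%:Z + cubic_sum - 7 - (1 + chi (-1)) * (2 + chi (s ^+ 2 - 1) + chi (1 - s ^+ 2)).
Proof.
pose f u := (1 + chi u) * (1 + chi (u + 1)) * (1 + chi (u + s ^+ 2)).
have d1 := sqr_sub1_neq0.
have s20 : s ^+ 2 != 0 by rewrite expf_neq0.
have s21 : 1 - s ^+ 2 != 0 by rewrite -opprB oppr_eq0.
have E1 : \sum_(u : F) f u = #|F|%:Z + cubic_sum - 3.
  pose g u := 1 + chi u + chi (u + 1) + chi (u + s ^+ 2) + chi ((u + 0) * (u + 1))
    + chi ((u + 0) * (u + s ^+ 2)) + chi ((u + 1) * (u + s ^+ 2))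
    + chi (u * (u + 1) * (u + s ^+ 2)).
  rewrite (eq_bigr g) => [|u _]; last by rewrite /f /g addr0 !chiM; ring.
  have sh c : \sum_(u : F) chi (u + c) = 0.
    by rewrite -[RHS]sum_chi [RHS](reindex_inj (addIr c)).
  have h01 : 0 != 1 :> F by rewrite eq_sym oner_neq0.
  have h0s : 0 != s ^+ 2 by rewrite eq_sym.
  have h1s : 1 != s ^+ 2 by rewrite -subr_eq0.
  rewrite /g !big_split /= sum_chi !sh !sum_chi_shift2 //.
  by rewrite sumr_const -/cubic_sum -mulr_natr; ring.
have E2 : 8 * #|square_triple|%:Z = \sum_(u : F) 8 * (square_triple u)%:Z.
  by rewrite -mulr_sumr -sum1_card big_mkcond (big_morph _ PoszD (erefl 0%:Z)) /=.
have n1 : -1 != 0 :> F by rewrite oppr_eq0 oner_eq0.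
have n2 : - s ^+ 2 != 0 by rewrite oppr_eq0.
have n3 : - s ^+ 2 != -1 by rewrite eqr_opp -subr_eq0.
have z0 : square_triple 0 = false by rewrite /square_triple chi0.
have z1 : square_triple (-1) = false by rewrite /square_triple addNr chi0 andbF.
have z2 : square_triple (- s ^+ 2) = false by rewrite /square_triple addNr chi0 !andbF.
have : \sum_(u : F) (f u - 8 * (square_triple u)%:Z) = #|F|%:Z + cubic_sum - 3 - 8 * #|square_triple|%:Z.
  by rewrite sumrB E1 E2.
rewrite (bigD1 0) //= (bigD1 (-1)) //= (bigD1 (- s ^+ 2)) ?n2 //= big1 => [|u]; last first.
  rewrite -!andbA => /and3P[u0 u1 u2]; rewrite /f /square_triple.
  rewrite -addr_eq0 in u1; rewrite -addr_eq0 in u2.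
  by case: (chi_pm1 u0) (chi_pm1 u1) (chi_pm1 u2) => -> [] -> [] ->.
rewrite z0 z1 z2 /f !add0r !addNr chi0 chi1 [-1 + _]addrC [- _ + 1]addrC.
rewrite (chiN (s ^+ 2)) chiX2 //.
move: (chi (-1)) (chi (s ^+ 2 - 1)) (chi (1 - s ^+ 2)) cubic_sum #|square_triple| #|F|.
by clear; lia.
Qed.

(** u -> s^2/u is the effect on abscissas of adding the 2-torsion point (0, 0) on y^2 = x (x + 1) (x
    + s^2). It exchanges the last two symbols when chi u = 1. *)
Lemma square_tripleV u : square_triple u -> square_triple (s ^+ 2 / u).
Proof.
move=> /and3P[/eqP u0 /eqP u1 /eqP u2].
have un0 : u != 0 by apply: contra_eqN u0 => /eqP ->; rewrite chi0.
have e1 : s ^+ 2 / u + 1 = (u + s ^+ 2) / u by field.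
have e2 : s ^+ 2 / u + s ^+ 2 = (u + 1) / u * s ^+ 2 by field.
rewrite /square_triple e2 e1 [s ^+ 2 / u]mulrC !chiMX2 //.
by rewrite (chiM (u + _)) (chiM (u + _)) chiV u0 u1 u2.
Qed.

(** As s + s^2 = s (s + 1), the third symbol is the product of the other two. *)
Lemma square_triple_s : square_triple s = (chi s == 1) && (chi (s + 1) == 1).
Proof.
have -> : square_triple s = [&& chi s == 1, chi (s + 1) == 1 & chi (s * (s + 1)) == 1].
  by rewrite /square_triple; do 4 f_equal; ring.
by rewrite chiM; do 2 case: eqP => //= ->.
Qed.

Lemma square_triple_Ns : square_triple (- s) = (chi (- s) == 1) && (chi (1 - s) == 1).
Proof.
have -> : square_triple (- s) = [&& chi (- s) == 1, chi (1 - s) == 1 & chi (- s * (1 - s)) == 1].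
  by rewrite /square_triple [- s + 1]addrC; do 4 f_equal; ring.
by rewrite (chiM (- s)); do 2 case: eqP => //= ->.
Qed.

Lemma card_square_triple_parity : exists k, #|square_triple| = (square_triple s + square_triple (- s) + k.*2)%N.
Proof.
have [||//|m] := @sum_involution F square_triple (fun u => s ^+ 2 / u) (fun=> 1%N).
- by move=> u; apply: square_tripleV.
- move=> u /andP[u1 _] /=; rewrite invf_div mulrC divfK // expf_neq0 //.
rewrite sum1_card => ->; exists m; congr (_ + _)%N.
have ns : (- s == s) = false by rewrite eq_sym eq_opp_neq0.
rewrite big_mkcond (bigD1 s) //= (bigD1 (- s)) ?ns //= big1 => [|u /andP[us uns]].
  rewrite expr2 mulfK // eqxx andbT invrN mulrN mulfK // eqxx andbT addn0.
  by do 2 case: square_triple.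
case: ifP => // /andP[/andP[/eqP u1 _] /eqP us2].
have u0 : u != 0 by apply: contra_eqN u1 => /eqP ->; rewrite chi0.
have /eqP : s ^+ 2 = u ^+ 2 by rewrite [RHS]expr2 -[X in _ * X]us2 mulrC divfK.
by rewrite eqf_sqr ![s == _]eq_sym (negPf us) eqr_oppLR (negPf uns).
Qed.

Lemma cubic_sum_mod16 : exists k : int, cubic_sum =
  8 * ((chi s == 1) && (chi (s + 1) == 1))%:Z
  + 8 * ((chi (- s) == 1) && (chi (1 - s) == 1))%:Z
  + 7 + (1 + chi (-1)) * (2 + chi (s ^+ 2 - 1) + chi (1 - s ^+ 2)) - #|F|%:Z + 16 * k.
Proof.
have [k E] := card_square_triple_parity; have := card_square_triple.
by exists k%:Z; rewrite -square_triple_s -square_triple_Ns; lia.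
Qed.

(* Up to scaling the variable by 1 - s^2, r * dual_quad r is the cubic 2-isogenous
   to y (y + 1) (y + s^2). *)
Definition dual_quad r := (s ^+ 2 - 1) * (r ^+ 2 + 1) + 2%:R * (s ^+ 2 + 1) * r.

(** For a = s^2 + 1 and b = s^2 one has a^2 - 4b = (s^2 - 1)^2. Setting y = -(s^2 - 1) r in the
    isogenous cubic turns it into -(s^2 - 1)^2 r Q(r), where Q is [dual_quad s]. *)
Lemma sum_chi_dual : \sum_(r : F) chi (r * dual_quad r) = chi (-1) * cubic_sum.
Proof.
have d1 := sqr_sub1_neq0.
have -> : cubic_sum = \sum_(y : F) chi (y * (y ^+ 2 + (s ^+ 2 + 1) * y + s ^+ 2)).
  by apply: eq_bigr => y _; congr chi; ring.
rewrite sum_chi_isogeny ?expf_neq0 // mulr_sumr.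
have c0 : - (s ^+ 2 - 1) != 0 by rewrite oppr_eq0.
rewrite [RHS](reindex_inj (mulfI c0)) /=; apply: eq_bigr => r _.
by rewrite -chiM -(chiMX2 _ d1); congr chi; rewrite /dual_quad; ring.
Qed.

Lemma dual_quadE r :
  dual_quad r = (s ^+ 2 - 1) * ((r + (s - 1) / (s + 1)) * (r + (s + 1) / (s - 1))).
Proof. by rewrite /dual_quad; field; rewrite sm1 sp1. Qed.

Lemma dual_roots_neq : (s - 1) / (s + 1) != (s + 1) / (s - 1).
Proof.
rewrite eqr_div // -subr_eq0.
have -> : (s - 1) * (s - 1) - (s + 1) * (s + 1) = - ((2%:R ^+ 2) * s) by ring.
by rewrite oppr_eq0 mulf_neq0 ?expf_neq0 ?two_neq0.
Qed.

Lemma sum_chi_dual_quad : \sum_(r : F) chi (dual_quad r) = - chi (s ^+ 2 - 1).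
Proof.
under eq_bigr => r _ do rewrite dual_quadE chiM.
by rewrite -mulr_sumr sum_chi_shift2 ?dual_roots_neq // mulrN1.
Qed.

Definition dual_count := #|[pred r | (chi r == -1) && (chi (dual_quad r) == -1)]|.

(** The product (1 - chi r)(1 - chi (Q r)) is 4 on the counted set and 0 off it, except at r = 0 and
    at the two roots of Q, where a vanishing symbol leaves the other factor as a correction. *)
Lemma card_dual : 4 * dual_count%:Z = #|F|%:Z + chi (-1) * cubic_sum
  + 2 * chi (s ^+ 2 - 1) + 2 * chi (-1) * chi (s ^+ 2 - 1) - 3.
Proof.
have d1 := sqr_sub1_neq0; have dn := dual_roots_neq.
pose A r := (chi r == -1) && (chi (dual_quad r) == -1).
pose f r := (1 - chi r) * (1 - chi (dual_quad r)).
have E1 : \sum_(r : F) f r = #|F|%:Z + chi (s ^+ 2 - 1) + chi (-1) * cubic_sum.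
  pose g r := 1 - chi r - chi (dual_quad r) + chi (r * dual_quad r).
  rewrite (eq_bigr g) => [|r _]; last by rewrite /f /g chiM; ring.
  rewrite /g !big_split /= !sumrN sum_chi sum_chi_dual sum_chi_dual_quad sumr_const.
  by rewrite -mulr_natr; ring.
have E2 : 4 * dual_count%:Z = \sum_(r : F) 4 * (A r)%:Z.
  by rewrite -mulr_sumr /dual_count -sum1_card big_mkcond (big_morph _ PoszD (erefl 0%:Z)).
have : \sum_(r : F) (f r - 4 * (A r)%:Z) =
    #|F|%:Z + chi (s ^+ 2 - 1) + chi (-1) * cubic_sum - 4 * dual_count%:Z.
  by rewrite sumrB E1 E2.
pose a := (s - 1) / (s + 1); pose b := (s + 1) / (s - 1).
have a0 : - a != 0 by rewrite oppr_eq0 mulf_neq0 ?invr_eq0.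
have b0 : - b != 0 by rewrite oppr_eq0 mulf_neq0 ?invr_eq0.
have ab : - b != - a by rewrite eqr_opp eq_sym.
have q0 : dual_quad 0 = s ^+ 2 - 1 by rewrite /dual_quad; ring.
have qa : dual_quad (- a) = 0 by rewrite dual_quadE addNr mul0r mulr0.
have qb : dual_quad (- b) = 0 by rewrite dual_quadE addNr !mulr0.
have ca : chi a = chi (s ^+ 2 - 1) by rewrite subr_sqr_1 !chiM chiV.
have cb : chi b = chi (s ^+ 2 - 1) by rewrite subr_sqr_1 !chiM chiV mulrC.
rewrite (bigD1 0) //= (bigD1 (- a)) //= (bigD1 (- b)) ?b0 //= big1 => [|r]; last first.
  rewrite -!andbA => /and3P[r0 r1 r2]; rewrite /f /A.
  rewrite -addr_eq0 in r1; rewrite -addr_eq0 in r2.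
  have qr : dual_quad r != 0 by rewrite dual_quadE !mulf_neq0.
  by case: (chi_pm1 r0) (chi_pm1 qr) => -> [] ->.
rewrite /A /f q0 qa qb chi0 (chiN a) (chiN b) ca cb.
move: (chi (-1)) (chi (s ^+ 2 - 1)) cubic_sum dual_count #|F|.
by clear; lia.
Qed.

End CubicSum.

(** The cubic becomes y (y + 1)^2, whose symbol is chi y except at y = -1. *)
Lemma cubic_sum_degenerate s : s ^+ 2 = 1 -> cubic_sum s = - chi (-1).
Proof.
move=> s1; rewrite /cubic_sum s1 (bigD1 (-1)) //= addNr !mulr0 chi0 add0r.
have /eqP := sum_chi; rewrite (bigD1 (-1)) //= addrC addr_eq0 => /eqP <-.
by apply: eq_bigr => y; rewrite -addr_eq0 -mulrA -expr2 => /chiMX2 ->.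
Qed.

(** Here Q(r) = 4r, so the count is that of all nonsquares. *)
Lemma dual_count_degenerate s : s ^+ 2 = 1 -> (dual_count s).*2.+1 = #|F|.
Proof.
move=> s1; have : \sum_(x : F) ((x != 0)%:Z - chi x) = 2 * (dual_count s)%:Z.
  rewrite /dual_count -sum1_card [in RHS]big_mkcond (big_morph _ PoszD (erefl 0%:Z)) mulr_sumr.
  apply: eq_bigr => x _; rewrite inE /dual_quad s1 subrr mul0r add0r.
  have -> : 2%:R * (1 + 1) * x = x * 2%:R ^+ 2 by ring.
  rewrite chiMX2 ?two_neq0 //; have [->|/chi_pm1[] ->] := eqVneq x 0; by rewrite ?chi0.
rewrite sumrB sum_chi subr0 (bigD1 0) //= eqxx add0r.
under eq_bigr => x x0 do rewrite x0.
rewrite sumr_const cardC1 [X in X = _]natz => /eqP; rewrite -PoszM eqz_nat mul2n => /eqP <-.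
by rewrite (ltn_predK (finNzRing_gt1 F)).
Qed.

End QuadraticCharacter.

(** * Legendre symbols as quadratic characters of prime fields *)

Section PrimeField.

Variable p : nat.
Hypotheses (pp : prime p) (p_gt2 : (2 < p)%N).

Lemma odd_card_Fp : odd #|'F_p|.
Proof. by rewrite card_Fp //; case: (even_prime pp) p_gt2 => [->|]. Qed.

Lemma val_Fp_small k : (k < p)%N -> (k%:R : 'F_p) = k :> nat.
Proof. by move=> kp; rewrite val_Fp_nat // modn_small. Qed.

Lemma ltn_Fp (x : 'F_p) : (x < p)%N.
Proof. by have := ltn_ord x; rewrite [X in (_ < X)%N]Fp_cast. Qed.

Lemma natr_Fp (x : 'F_p) : (x : nat)%:R = x.
Proof. by apply: val_inj; rewrite /= val_Fp_small ?ltn_Fp. Qed.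

Lemma big_Fp (R : Type) (idx : R) (op : R -> R -> R) (P : pred nat) (f : nat -> R) :
  \big[op/idx]_(i < p | P i) f i = \big[op/idx]_(x : 'F_p | P x) f x.
Proof. by rewrite -(big_mkord P f) -[in LHS](Fp_cast pp) big_mkord. Qed.

Lemma intr_Fp_eq0 (a : int) : ((a%:~R : 'F_p) == 0) = (p %| a)%Z.
Proof. by rewrite (dvdz_pcharf (pchar_Fp pp)). Qed.

Lemma legendre_chi (a : int) : legendre p a = chi (a%:~R : 'F_p).
Proof.
have oF := odd_card_Fp; rewrite /legendre -intr_Fp_eq0; have [->|a0] := eqVneq; first by rewrite chi0.
have -> : [exists x : 'I_p, (x%:Z ^+ 2 == a %[mod p])%Z] =
          [exists y : 'F_p, y ^+ 2 == a%:~R].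
  have E k : (k%:Z ^+ 2 == a %[mod p])%Z = ((k%:R : 'F_p) ^+ 2 == a%:~R).
    by rewrite eqz_mod_dvd -intr_Fp_eq0 rmorphB rmorphXn /= subr_eq0.
  apply/existsP/existsP => -[x xP].
    by exists (x : nat)%:R; rewrite -E.
  by exists (Ordinal (ltn_Fp x)); rewrite E /= natr_Fp.
case: existsP => [[y /eqP yP]|no].
  by rewrite -yP chiX2 //; apply: contraNneq a0 => y0; rewrite -yP y0 expr0n.
case: (chi_pm1 a0) => // /(euler odd_card_Fp)[y yP].
by case: no; exists y; rewrite yP.
Qed.

Lemma F01_chi (n : int) :
  F01 p n = \sum_(y : 'F_p) chi (y * (y + 1) * (y + n%:~R)).
Proof.
pose f k := legendre p (k%:Z * (k%:Z + 1) * (k%:Z + n)).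
have fE k : f k = chi ((k%:R : 'F_p) * (k%:R + 1) * (k%:R + n%:~R)).
  by rewrite /f legendre_chi !rmorphM !rmorphD.
(* The range 1, ..., p becomes 0, ..., p - 1 by moving its last term to 0. *)
have p0 : f p = f 0%N by rewrite !fE pchar_Fp_0.
rewrite /F01 -[LHS]/(\sum_(1 <= y < p.+1) f y) big_nat_recr ?prime_gt0 //= p0 addrC.
rewrite -big_ltn ?prime_gt0 // big_mkord (big_Fp _ _ predT).
by apply: eq_bigr => y _; rewrite fE natr_Fp.
Qed.

(** * The half-system 1, ..., (p - 1)/2 and Gauss's lemma *)

Definition half (x : 'F_p) := (0 < x)%N && (2 * x < p)%N.

Lemma val_FpN (x : 'F_p) : x != 0 -> (- x : 'F_p) = (p - x)%N :> nat.
Proof.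
move=> x0; have xp := ltn_Fp x.
have -> : - x = (p - x)%:R by rewrite natrB ?(ltnW xp) // pchar_Fp_0 // sub0r natr_Fp.
rewrite val_Fp_small //; have : (x : nat) <> 0%N by move=> x1; case/eqP: x0; rewrite -[x]natr_Fp x1.
by lia.
Qed.

Lemma half_neq0 x : half x -> x != 0.
Proof. by case/andP => + _; apply: contraTneq => ->. Qed.

Lemma halfN x : x != 0 -> half (- x) = ~~ half x.
Proof.
move=> x0; rewrite /half val_FpN //; have := ltn_Fp x.
have : (x : nat) <> 0%N by move=> x1; case/eqP: x0; rewrite -[x]natr_Fp x1.
by have := odd_card_Fp; rewrite card_Fp //; lia.
Qed.

Lemma sum_half (f : nat -> nat) :
  (\sum_(x : 'F_p | half x) f x = \sum_(1 <= i < p./2.+1) f i)%N.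
Proof.
rewrite -[LHS](big_Fp _ _ (fun i => (0 < i) && (2 * i < p))%N f) -[LHS](big_mkord (fun i => (0 < i) && (2 * i < p))%N f).

rewrite (@big_nat_widenl _ _ _ 1 0) // [RHS](@big_nat_widen _ _ _ 0 _ p) /=; last first.
  by have := prime_gt1 pp; lia.
apply: eq_bigl => i; have := odd_card_Fp; rewrite card_Fp //; lia.
Qed.

Lemma card_half : #|half| = #|'F_p|./2.
Proof.
rewrite -sum1_card (sum_half (fun=> 1%N)) sum_nat_const_nat card_Fp //.
by rewrite muln1 subSS subn0.
Qed.

(** Up to signs, x -> r x permutes the half-system. Comparing the product of its elements before and
    after shows that r^((p-1)/2) is the product of these signs. *)
Lemma gauss (r : 'F_p) : r != 0 -> chi r = (-1) ^+ #|[pred x | half x & ~~ half (r * x)]|.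
Proof.
move=> r0; have n1 := one_neq_neg1 odd_card_Fp.
apply: chi_inj; first exact: odd_card_Fp.
  by rewrite -signr_odd; case: odd.
pose m x := if half (r * x) then r * x else - (r * x).
have mH x : half x -> half (m x).
  rewrite /m => xh; case: ifPn => // nh; rewrite halfN //.
  by apply: mulf_neq0 => //; apply: half_neq0.
have minj : {in half &, injective m}.
  move=> x y xh yh mxy; have : x = y \/ x = - y.
    move: mxy; rewrite /m; do 2 case: ifP => _.
    - by move/(mulfI r0); left.
    - by rewrite -mulrN => /(mulfI r0); right.
    - by rewrite -mulrN => /(mulfI r0) <-; rewrite opprK; right.
    - by move/oppr_inj/(mulfI r0); left.
  case=> // xy; move: (xh : half x); rewrite xy halfN ?half_neq0 //.
  by rewrite (yh : half y).
have mE : m @: half = [set x in half].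
  apply/eqP; rewrite eqEcard (card_in_imset minj) cardsE leqnn andbT.
  by apply/subsetP => _ /imsetP[x xh ->]; rewrite inE; apply: mH.
pose P : 'F_p := \prod_(x | half x) x.
have P0 : P != 0 by apply/prodf_neq0 => x; apply: half_neq0.
apply: (mulIf P0).
have E : P = \prod_(x | half x) m x.
  transitivity (\prod_(x in m @: half) x); last by rewrite big_imset.
  by apply: eq_bigl => x; rewrite mE inE.
have rE : r ^+ #|'F_p|./2 = \prod_(x | half x) r by rewrite -card_half -prodr_const.
rewrite rE [in RHS]/P -[RHS]big_split /= {}E.
rewrite rmorphXn /= rmorphN1 -prodr_const.
have -> : \prod_(x in [pred x | half x & ~~ half (r * x)]) (-1 : 'F_p) =
  \prod_(x | half x) (if half (r * x) then 1 else -1).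
  by rewrite big_mkcondr /=; apply: eq_bigr => x _; case: half.
rewrite -big_split /=; apply: eq_bigr => x _; rewrite /m.
by case: ifP; rewrite ?mul1r // mulN1r opprK.
Qed.

Lemma sum_leqn a q : (q < a)%N -> (\sum_(1 <= k < a) (k <= q) = q)%N.
Proof.
move=> qa; rewrite (big_cat_nat (n := q.+1)) //= [X in (_ + X)%N]big_nat_cond.
rewrite [X in (_ + X)%N]big1 ?addn0 => [|k]; last by case: leqP => //; lia.
rewrite big_nat_cond (eq_bigr (fun=> 1%N)) => [|k]; last by case: leqP => //; lia.
by rewrite -big_nat_cond sum_nat_const_nat muln1 subSS subn0.
Qed.

(** The element a x leaves the half-system exactly when floor(2ax/p) is odd. Counting the lattice
    points under these floors by k rather than by i leaves a sum whose range depends on a alone,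
    ready for comparing two primes. *)
Lemma gauss_exponent (a : nat) : (0 < a)%N -> ~~ (p %| a)%N ->
  odd #|[pred x : 'F_p | half x & ~~ half (a%:R * x)]| =
  odd (\sum_(1 <= k < a) (p./2 - (k * p) %/ (2 * a)))%N.
Proof.
move=> a0 pa; have p0 := prime_gt0 pp.
have oddp : odd p by have := odd_card_Fp; rewrite card_Fp.
have E1 (x : 'F_p) : half x -> ~~ half (a%:R * x) = odd ((2 * a * x) %/ p)%N.
  move=> xh; have x0 := half_neq0 xh.
  have ax0 : a%:R * x != 0 by rewrite mulf_neq0 // -(dvdn_pcharf (pchar_Fp pp)).
  have v : (a%:R * x : 'F_p) = ((a * x) %% p)%N :> nat.
    by rewrite -[in LHS](natr_Fp x) -natrM val_Fp_nat.
  have v0 : ((a * x) %% p)%N <> 0%N.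
    by rewrite -v => v0; case/eqP: ax0; rewrite -[LHS]natr_Fp v0.
  have -> : (2 * a * x = ((a * x) %/ p).*2 * p + 2 * ((a * x) %% p))%N.
    by rewrite -mulnA {1}(divn_eq (a * x) p); lia.
  rewrite /half v; move: v0 (ltn_pmod (a * x) p0).
  set u := ((a * x) %% p)%N; set w := ((a * x) %/ p)%N => u0 up.
  rewrite divnMDl // oddD odd_double /=.
  have -> /= : (0 < u)%N by lia.
  case: (ltnP (2 * u) p) => h /=; first by rewrite divn_small.
  by rewrite -(subnKC h) divnDl // divnn p0 divn_small //; clear -up h; lia.
have -> : odd #|[pred x : 'F_p | half x & ~~ half (a%:R * x)]| =
    odd (\sum_(x : 'F_p | half x) (2 * a * x) %/ p)%N.
  rewrite -sum1_card big_mkcondr /=.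
  apply: (big_ind2 (fun x y => odd x = odd y)) => // [x1 x2 y1 y2 h1 h2|x xh].
    by rewrite !oddD h1 h2.
  by rewrite E1 //; case: ifP.
rewrite (sum_half (fun i => (2 * a * i) %/ p)%N); congr odd.
(* Each floor counts the k >= 1 with k p <= 2 a i; such k stay below a because 2 i < p. *)
transitivity (\sum_(1 <= i < p./2.+1) \sum_(1 <= k < a) (k * p <= 2 * a * i))%N.
  rewrite big_nat_cond [RHS]big_nat_cond; apply: eq_bigr => i; rewrite andbT => ip.
  rewrite -[LHS](@sum_leqn a) ?ltn_divLR //; last by nia.
  by apply: eq_bigr => k _; rewrite leq_divRL.
rewrite exchange_big_nat /= big_nat_cond [RHS]big_nat_cond.
apply: eq_bigr => k; rewrite andbT => /andP[k0 ka].
set c := ((k * p) %/ (2 * a))%N.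
have cp : (c < p./2.+1)%N by rewrite ltn_divLR; nia.
(* For fixed k each i satisfies exactly one of 2 a i <= k p and k p <= 2 a i: equality would make p
   divide 2 a i. *)
have E : (\sum_(1 <= i < p./2.+1) ((i <= c) + (k * p <= 2 * a * i)) = p./2)%N.
  rewrite big_nat_cond (eq_bigr (fun=> 1%N)) => [|i]; last first.
    rewrite andbT => ip; rewrite /c leq_divRL; last lia.
    rewrite [(i * _)%N]mulnC; case: ltngtP => //= e.
    have : (p %| 2 * a * i)%N by rewrite e dvdn_mull.
    rewrite !Euclid_dvdM // (negPf pa) !gtnNdvd //; lia.
  by rewrite -big_nat_cond sum_nat_const_nat muln1 subSS subn0.
by rewrite -[in RHS]E big_split /= sum_leqn // addKn.
Qed.

(** * Pairs in the half-system, grouped by ratio *)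

Definition half_pairs : {set 'F_p * 'F_p} :=
  [set z : 'F_p * 'F_p | [&& (0 < z.1)%N, (z.1 < z.2)%N & (2 * z.2 < p)%N]].

(* The parity of [i + j] versus [j - i] tells which branch of the fold was taken,
   since n is odd. *)
Lemma pair_fold_inj (n i j k l : nat) : odd n ->
  [&& 0 < i, i < j & 2 * j < n]%N -> [&& 0 < k, k < l & 2 * l < n]%N ->
  (j - i = l - k)%N ->
  (if 2 * (i + j) < n then i + j else n - (i + j))%N =
    (if 2 * (k + l) < n then k + l else n - (k + l))%N -> i = k /\ j = l.
Proof. by move=> on /and3P[? ? ?] /and3P[? ? ?] ?; do 2 case: ifP; lia. Qed.

Lemma pair_fold_mem (n i j : nat) : odd n ->
  [&& 0 < i, i < j & 2 * j < n]%N ->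
  let k := (if 2 * (i + j) < n then i + j else n - (i + j))%N in
  [&& 0 < j - i, j - i < k & 2 * k < n]%N.
Proof. by move=> on /and3P[? ? ?] /=; case: ifP; lia. Qed.

(** The map [t] is (i, j) -> (j - i, i + j), with i + j replaced by p - (i + j) when it exceeds p/2.
    Being injective on a finite set it is a permutation, and evenness of [f] in its second argument
    absorbs the sign. *)
Lemma prod_half_pairs_fold (f : 'F_p -> 'F_p -> int) :
  (forall x y, f x (- y) = f x y) ->
  \prod_(z in half_pairs) f z.1 z.2 =
  \prod_(z in half_pairs) f (z.2 - z.1) (z.1 + z.2).
Proof.
move=> fN; have oddp : odd p by have := odd_card_Fp; rewrite card_Fp.
pose t (z : 'F_p * 'F_p) : 'F_p * 'F_p := ((z.2 - z.1)%N%:R,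
  (if 2 * (z.1 + z.2) < p then z.1 + z.2 else p - (z.1 + z.2))%N%:R).
have t1 z : z \in half_pairs -> (t z).1 = (z.2 - z.1)%N :> nat.
  by move=> _; rewrite val_Fp_small // (leq_ltn_trans (leq_subr _ _)) ?ltn_Fp.
have t2 z : z \in half_pairs -> (t z).2 = (if 2 * (z.1 + z.2) < p then z.1 + z.2 else p - (z.1 + z.2))%N :> nat.
  by rewrite inE => zP; rewrite val_Fp_small //; case: ifP; lia.
have tinj : {in half_pairs &, injective t}.
  move=> z w zP wP tzw; have := t1 _ zP; have := t2 _ zP.
  rewrite tzw t1 // t2 //; move: zP wP; rewrite !inE => zP wP e2 e1.
  have [v1 v2] := pair_fold_inj oddp wP zP e1 e2.
  by case: z w v1 v2 {zP wP tzw e1 e2} => [z1 z2] [w1 w2] /= /val_inj -> /val_inj ->.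
have tP : t @: half_pairs = half_pairs.
  apply/eqP; rewrite eqEcard (card_in_imset tinj) leqnn andbT.
  apply/subsetP => _ /imsetP[z zP ->]; rewrite inE t1 // t2 //.
  by rewrite inE in zP; apply: pair_fold_mem.
rewrite -[in LHS]tP big_imset //=; apply: eq_bigr => z; rewrite inE => /and3P[_ /ltnW z12 z2p].
have z12p : (z.1 + z.2 <= p)%N.
  by apply: leq_trans (ltnW z2p); rewrite mul2n -addnn leq_add2r.
have -> : ((z.2 - z.1)%N%:R : 'F_p) = z.2 - z.1 by rewrite natrB ?natr_Fp.
case: ifP => _; first by rewrite natrD !natr_Fp.
by rewrite natrB // pchar_Fp_0 // sub0r fN natrD !natr_Fp.
Qed.

Definition half_count (r : 'F_p) := #|[pred x | half x & half (r * x)]|.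

(** For x in the half-system, r x lies in it exactly when - r x does not, so this is Gauss's lemma
    for - r. *)
Lemma odd_half_count r : r != 0 -> odd (half_count r) = (chi (- r) == -1).
Proof.
move=> r0; rewrite gauss ?oppr_eq0 //.
have -> : #|[pred x | half x & ~~ half (- r * x)]| = half_count r.
  apply: eq_card => x; rewrite !inE; case xh: (half x) => //=.
  by rewrite mulNr halfN ?negbK // mulf_neq0 //; apply: half_neq0.
by rewrite -signr_odd; case: odd.
Qed.

Lemma half_countV r : r != 0 -> half_count r^-1 = half_count r.
Proof.
move=> r0; rewrite /half_count -[RHS](card_image (mulfI r0)).
apply: eq_card => x; rewrite !inE; apply/andP/imageP => [[x1 x2]|[y]].
  by exists (r^-1 * x); rewrite ?inE mulVKf ?x1 ?x2.
by rewrite inE => /andP[y1 y2] ->; rewrite mulKf.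
Qed.

Lemma half_countN1 : half_count (-1) = 0%N.
Proof.
by apply: eq_card0 => x; rewrite !inE mulN1r; apply/andP => -[xh]; rewrite halfN ?half_neq0 ?xh.
Qed.

(** Doubling removes the order on the pairs, and each ratio r then contributes [half_count r].
    Modulo 4 only the parities of these counts survive, because r and 1/r contribute equally. *)
Lemma card_half_pairs_mod4 (g : pred 'F_p) : (forall r : 'F_p, g r^-1 = g r) ->
  exists k, (#|[pred z in half_pairs | g (z.2 / z.1)]|.*2 =
   #|[pred r : 'F_p | [&& r != 0, r != 1, r != -1, chi (- r) == -1 & g r]%R]| + 4 * k)%N.
Proof.
move=> gV; set N := #|_|.
pose A (z : 'F_p * 'F_p) := [&& half z.1, half z.2, z.1 != z.2 & g (z.2 / z.1)].
pose R (r : 'F_p) := [&& r != 0, r != 1, r != -1 & g r].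
have E1 : N.*2 = (\sum_(z | A z) 1)%N.
  rewrite (bigID (fun z : 'F_p * 'F_p => z.1 < z.2)%N) /= -addnn; congr (_ + _)%N.
    rewrite /N -sum1_card; apply: eq_bigl => z; rewrite !inE /A /half -val_eqE /=.
    by case: (g _); rewrite ?andbF // !andbT; lia.
  have hK : involutive (fun z : 'F_p * 'F_p => (z.2, z.1)) by case.
  rewrite (reindex_inj (inv_inj hK)) /N -sum1_card; apply: eq_bigl => z.
  rewrite !inE /A /half -[_ / z.2]invf_div gV -val_eqE /=.
  by case: (g _); rewrite ?andbF // !andbT; lia.
have E2 : (\sum_(z | A z) 1 = \sum_(r | R r) half_count r)%N.
  rewrite -(pair_big_dep xpredT (fun x y => A (x, y)) (fun _ _ => 1%N)) /=.
  transitivity (\sum_(x | half x) \sum_(r : 'F_p | [&& half (r * x), r != 1 & g r]%R) 1)%N.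
    rewrite [RHS]big_mkcond /=; apply: eq_bigr => x _; rewrite /A /=.
    case: ifP => xh /=; last by rewrite big_pred0.
    have x0 := half_neq0 xh; rewrite (reindex_inj (mulIf x0)) /=.
    apply: eq_bigl => r; rewrite mulfK //; congr [&& _, ~~ _ & _].
    by rewrite -[X in X == _]mul1r (inj_eq (mulIf x0)) eq_sym.
  rewrite (exchange_big_dep (fun r : 'F_p => [&& r != 0, r != 1 & g r])) /=; last first.
    move=> x r xh /and3P[rx -> ->]; rewrite !andbT.
    by apply: contraTneq (half_neq0 rx) => ->; rewrite mul0r eqxx.
  rewrite (bigID (fun r => r == -1)) /= big1 ?add0n => [|r /andP[r1 /eqP rN]]; last first.
    apply: etrans half_countN1; rewrite sum1_card /half_count -rN; apply: eq_card => x.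
    by move: r1; rewrite !inE unfold_in => /and3P[_ -> ->]; rewrite !andbT.
  apply: eq_big => [r|r /andP[/and3P[r0 r1 r2] r3]].
    by rewrite /R; case: (r == -1); case: (g r); rewrite ?andbF ?andbT.
  rewrite sum1_card; apply: eq_card => x.
  by rewrite !inE unfold_in r1 r2 !andbT.
(* The halved counts have an even sum: inversion preserves them, and its fixed points 1 and -1 are
   excluded from [R]. Doubling gives a multiple of 4. *)
have [||r _|m E3] := @sum_involution _ R (@GRing.inv _) (fun r => (half_count r)./2).
- move=> r /and4P[r0 r1 r2 r3]; rewrite /R invr_eq0 invr_eq1 gV r0 r1 r3 andbT /=.
  by apply: contraNneq r2 => rN; rewrite -[r]invrK rN invrN1.
- by move=> r _; apply: invrK.
- by have [->|r0] := eqVneq r 0; rewrite ?invr0 // half_countV.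
exists m; rewrite E1 E2 (eq_bigr (fun r => odd (half_count r) + 2 * (half_count r)./2)%N); last first.
  by move=> r _; rewrite mul2n odd_double_half.
rewrite big_split /= -big_distrr /= {}E3 [X in (2 * (X + _))%N]big_pred0 => [|r]; last first.
  apply/negP => /andP[/and4P[r0 r1 r2 _] /eqP rr].
  have /eqP : r ^+ 2 = 1 by rewrite expr2 -{1}rr mulVf.
  by rewrite sqrf_eq1 (negPf r1) (negPf r2).
congr (_ + _)%N; last by lia.
rewrite -sum1_card [RHS](eq_bigl (fun r => R r && odd (half_count r))) => [|r]; last first.
  rewrite inE /R; case: (eqVneq r 0) => //= r0; rewrite odd_half_count //.
  by rewrite -!andbA [g r && _]andbC.
by rewrite [RHS]big_mkcondr; apply: eq_bigr => r _; case: odd.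
Qed.

Lemma prod_half_pairs (s : 'F_p) : exists N k : nat,
  \prod_(x : 'F_p) \prod_(y : 'F_p | [&& (0 < x)%N, (x < y)%N, (2 * y < p)%N
       & s ^+ 2 * x ^+ 2 - y ^+ 2 != 0]) chi (s ^+ 2 * x ^+ 2 - y ^+ 2) = (-1) ^+ N
  /\ (dual_count s + 4 * k = N.*2 + (chi (-1 : 'F_p) == -1)%R)%N.
Proof.
have oF := odd_card_Fp; have n1 : -1 != 0 :> 'F_p by rewrite oppr_eq0 oner_eq0.
(* Giving 0 the value 1 removes the nonvanishing condition, so that the product runs over all of
   [half_pairs] and can be permuted. *)
pose c (v : 'F_p) : int := if v == 0 then 1 else chi v.
have cE v : c v = (-1) ^+ (chi v == -1).
  by rewrite /c; have [->|v0] := eqVneq v 0; rewrite ?chi0 //; case: (chi_pm1 v0) => ->.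
pose g (r : 'F_p) := chi (dual_quad s (- r)) == -1.
have QV r : r != 0 -> dual_quad s (- r) = dual_quad s (- r^-1) * r ^+ 2.
  by move=> r0; rewrite /dual_quad; field.
have gV r : g r^-1 = g r.
  have [->|r0] := eqVneq r 0; first by rewrite invr0.
  by rewrite /g [in RHS]QV // chiMX2.
have [k kE] := card_half_pairs_mod4 gV.
exists #|[pred z in half_pairs | g (z.2 / z.1)]|, k; split.
  transitivity (\prod_(z in half_pairs) c (s ^+ 2 * z.1 ^+ 2 - z.2 ^+ 2)).
    rewrite pair_big_dep /= big_mkcond [RHS]big_mkcond; apply: eq_bigr => z _.
    rewrite inE /c; case: eqP => _ /=; first by rewrite !andbF; case: ifP.
    by rewrite andbT.
  rewrite (prod_half_pairs_fold (f := fun x y => c (s ^+ 2 * x ^+ 2 - y ^+ 2))) => [|x y]; last first.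
    by rewrite sqrrN.
  rewrite -prodr_const big_mkcondr /=; apply: eq_bigr => z; rewrite inE => /and3P[z1 _ _].
  have z0 : z.1 != 0 by apply: contraTneq z1 => ->.
  have -> : s ^+ 2 * (z.2 - z.1) ^+ 2 - (z.1 + z.2) ^+ 2 = dual_quad s (- (z.2 / z.1)) * z.1 ^+ 2.
    by rewrite /dual_quad; field.
  by rewrite cE chiMX2 // /g; case: eqP.
rewrite {}kE addnAC; congr (_ + _)%N.
rewrite /dual_count (cardD1 (-1 : 'F_p)) inE addnC.
(* The value at r = -1 is -4, so this point is counted exactly when chi (-1) = -1; it is the one
   point of [dual_count] missed by the ratio count. *)
have -> : dual_quad s (-1) = - 1 * 2%:R ^+ 2 by rewrite /dual_quad; ring.
rewrite chiMX2 ?two_neq0 // andbb; congr (_ + _)%N.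
rewrite -[LHS](card_image (@oppr_inj 'F_p)); apply: eq_card => r.
rewrite -[r in LHS]opprK mem_image ?inE; last exact: oppr_inj.
rewrite /g eqr_oppLR opprK; have [->|r0] := eqVneq r 0; first by rewrite oppr0 chi0.
by have [->|r1] := eqVneq r (-1); rewrite ?opprK ?chi1 ?andbF //= andbA.
Qed.

End PrimeField.

(** * Periodicity in p of Legendre symbols, of the cubic sum and of the dual count *)

Lemma legendre_nat_periodic (p1 p2 a : nat) :
  prime p1 -> (2 < p1)%N -> prime p2 -> (2 < p2)%N -> (0 < a)%N ->
  ~~ (p1 %| a)%N -> ~~ (p2 %| a)%N -> p1 = p2 %[mod 4 * a] ->
  legendre p1 a = legendre p2 a.
Proof.
move=> pp1 p1_gt2 pp2 p2_gt2 a0 p1a p2a E.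
have c (p : nat) : prime p -> (2 < p)%N -> ~~ (p %| a)%N -> legendre p a =
    (-1) ^+ odd (\sum_(1 <= k < a) (p./2 - (k * p) %/ (2 * a)))%N.
  move=> pp p_gt2 pa; rewrite legendre_chi // gauss //.
    by rewrite -(gauss_exponent pp p_gt2) // signr_odd.
  by rewrite -(dvdn_pcharf (pchar_Fp pp)).
rewrite !c //; congr (_ ^+ nat_of_bool _).
rewrite big_nat_cond [in RHS]big_nat_cond.
apply: (big_ind2 (fun x y => odd x = odd y)) => // [x1 x2 y1 y2 h1 h2|k].
  by rewrite !oddD h1 h2.
rewrite andbT => /andP[_ ka].
wlog p12 : p1 p2 {pp1 p1_gt2 pp2 p2_gt2 p1a p2a c} E / (p1 <= p2)%N.
  by move=> h; case: (leqP p1 p2) => [|/ltnW] l; [exact: h | apply/esym/h].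
have /dvdnP[m mP] : (4 * a %| p2 - p1)%N by rewrite -eqn_mod_dvd //; apply/eqP.
have {mP p12 E} -> : p2 = (p1 + m * (4 * a))%N by rewrite -mP subnKC.
(* Adding 4am to p raises p./2 by 2am and the floor by 2km, so each term keeps its parity. This
   bound, and k m <= m a below, make the truncated subtractions exact. *)
have le : ((k * p1) %/ (2 * a) <= p1./2)%N.
  rewrite -divn2 -(@divnMr a p1 2) //; apply: leq_div2r.
  by rewrite mulnC leq_mul2l (ltnW ka) orbT.
have -> : (k * (p1 + m * (4 * a)) = k * m * 2 * (2 * a) + k * p1)%N by ring.
rewrite divnMDl ?muln_gt0 //.
have -> : ((p1 + m * (4 * a))./2 = p1./2 + m * 2 * a)%N by lia.
have : (k * m <= m * a)%N by rewrite mulnC leq_mul2l (ltnW ka) orbT.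
move: (_ %/ _)%N le => c; set km := (k * m)%N; set ma := (m * a)%N.
rewrite -mulnA [(2 * a)%N]mulnC mulnA -/ma; lia.
Qed.

Lemma legendreM p a b : prime p -> (2 < p)%N ->
  legendre p (a * b) = legendre p a * legendre p b.
Proof. by move=> pp p2; rewrite !legendre_chi // rmorphM chiM // odd_card_Fp. Qed.

Lemma legendreN1 p : prime p -> (2 < p)%N -> legendre p (-1) = (-1) ^+ odd (p./2).
Proof.
move=> pp p2; have oF := odd_card_Fp pp p2; rewrite legendre_chi //.
apply: (chi_inj oF); first by case: odd.
by rewrite signr_odd rmorphXn /= rmorphN1 card_Fp.
Qed.

Lemma legendre_periodic (p1 p2 : nat) (a : int) :
  prime p1 -> (2 < p1)%N -> prime p2 -> (2 < p2)%N ->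
  ~~ (p1 %| a)%Z -> ~~ (p2 %| a)%Z -> p1 = p2 %[mod 4 * `|a|] ->
  legendre p1 a = legendre p2 a.
Proof.
move=> pp1 p12 pp2 p22 pa1 pa2 E.
have a0 : (0 < `|a|)%N by rewrite absz_gt0; apply: contraNneq pa1 => ->; rewrite dvdz0.
have L := legendre_nat_periodic pp1 p12 pp2 p22 a0 pa1 pa2 E.
have E4 : p1 = p2 %[mod 4] by rewrite -(modn_dvdm p1 (dvdn_mulr `|a| (dvdnn 4))) E modn_dvdm ?dvdn_mulr.
have [ap|an] := ger0P a; first by rewrite -(gez0_abs ap).
have -> : a = -1 * `|a|%N%:Z by rewrite mulN1r ltz0_abs ?opprK.
rewrite !legendreM // L !legendreN1 //; congr ((-1) ^+ nat_of_bool _ * _).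
by clear -E4; lia.
Qed.

Lemma prod_legendre_Fp p (s : int) : prime p -> (2 < p)%N ->
  let q (i j : nat) : int := s ^+ 2 * i%:Z ^+ 2 - j%:Z ^+ 2 in
  \prod_(i < p) \prod_(j < p | [&& (0 < i)%N, (i < j)%N, (2 * j < p)%N
                                      & ~~ (p %| q i j)%Z]) legendre p (q i j) =
  \prod_(x : 'F_p) \prod_(y : 'F_p | [&& (0 < x)%N, (x < y)%N, (2 * y < p)%N
       & s%:~R ^+ 2 * x ^+ 2 - y ^+ 2 != 0]) chi (s%:~R ^+ 2 * x ^+ 2 - y ^+ 2).
Proof.
move=> pp p2 q; have qE (x y : 'F_p) : (q x y)%:~R = s%:~R ^+ 2 * x ^+ 2 - y ^+ 2 :> 'F_p.
  by rewrite rmorphB rmorphM !rmorphXn /= -!pmulrn !natr_Fp.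
rewrite (big_Fp pp _ _ predT (fun i => \prod_(j < p | [&& (0 < i)%N, (i < j)%N, (2 * j < p)%N
                                      & ~~ (p %| q i j)%Z]) legendre p (q i j))).
apply: eq_bigr => x _.
rewrite (big_Fp pp _ _ (fun j => [&& (0 < x)%N, (x < j)%N, (2 * j < p)%N
                                      & ~~ (p %| q x j)%Z]) (fun j => legendre p (q x j))).
by apply: eq_big => [y|y _]; rewrite ?legendre_chi -?intr_Fp_eq0 ?qE.
Qed.

Lemma F01_sqr p (s : int) : prime p -> (2 < p)%N ->
  F01 p (s ^+ 2) = cubic_sum (s%:~R : 'F_p).
Proof. by move=> pp p2; rewrite F01_chi // rmorphXn. Qed.

Lemma F01_sqr_residues p (s : int) : prime p -> (2 < p)%N ->
    ~~ (p %| s)%Z -> ~~ (p %| s ^+ 2 - 1)%Z ->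
  (exists k : int, F01 p (s ^+ 2) =
    8 * ((legendre p s == 1) && (legendre p (s + 1) == 1))%:Z
    + 8 * ((legendre p (- s) == 1) && (legendre p (1 - s) == 1))%:Z + 7
    + (1 + legendre p (-1)) * (2 + legendre p (s ^+ 2 - 1) + legendre p (1 - s ^+ 2))
    - p%:Z + 16 * k) /\
  4 * (dual_count (s%:~R : 'F_p))%:Z = p%:Z + legendre p (-1) * F01 p (s ^+ 2)
    + 2 * legendre p (s ^+ 2 - 1) + 2 * legendre p (-1) * legendre p (s ^+ 2 - 1) - 3.
Proof.
move=> pp p2; have oF := odd_card_Fp pp p2; set t := s%:~R : 'F_p.
rewrite -(intr_Fp_eq0 pp s) -(intr_Fp_eq0 pp (s ^+ 2 - 1)) => t0 st.
have /andP[tm tp] : (t - 1 != 0) && (t + 1 != 0).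
  by rewrite -negb_or -mulf_eq0 -subr_sqr_1 -rmorphXn -[1]/(1%:~R) -rmorphB.
have [k] := cubic_sum_mod16 oF t0 tp tm; have := card_dual oF t0 tp tm.
rewrite F01_sqr // -/t card_Fp // !legendre_chi //.
rewrite !(rmorphB, rmorphD, rmorphN, rmorphXn, rmorph1) /= -/t => -> E.
by split=> //; exists k.
Qed.

(** The factor 16 of [m] fixes p modulo 16; the others make all the symbols involved periodic, their
    arguments dividing s (s^2 - 1). For s = 1 or -1 the factor s^2 - 1 vanishes, so 1 replaces it
    and the degenerate formulas apply. *)
Lemma periodicity_transfer (s : int) (m p1 p2 : nat) : s != 0 ->
    m = (16 * (`|s| * (if s ^+ 2 == 1 then 1 else `|s ^+ 2 - 1|)))%N ->
    prime p1 -> (3 < p1)%N -> ~~ (p1 %| s)%Z ->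
    prime p2 -> (3 < p2)%N -> ~~ (p2 %| s)%Z -> p1 = p2 %[mod m] ->
  [/\ legendre p1 (-1) = legendre p2 (-1),
    exists k : int, F01 p1 (s ^+ 2) = F01 p2 (s ^+ 2) + 16 * k &
    exists k : int, (dual_count (s%:~R : 'F_p1))%:Z = (dual_count (s%:~R : 'F_p2))%:Z + 4 * k].
Proof.
move=> s0 mE pp1 p13 s1 pp2 p23 s2 E.
have p12 := ltnW p13; have p22 := ltnW p23.
have E16 : p1 = p2 %[mod 16].
  by rewrite -(@modn_dvdm m p1) ?E ?modn_dvdm // mE dvdn_mulr.
have L1 : legendre p1 (-1) = legendre p2 (-1).
  by rewrite !legendreN1 //; congr ((-1) ^+ nat_of_bool _); clear -E16; lia.
have [s21|s21] := eqVneq (s ^+ 2) 1.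
  have deg n : prime n -> (2 < n)%N -> F01 n (s ^+ 2) = - legendre n (-1) /\
      ((dual_count (s%:~R : 'F_n)).*2.+1 = n)%N.
    move=> pn n2; have oF := odd_card_Fp pn n2.
    have t1 : (s%:~R : 'F_n) ^+ 2 = 1 by rewrite -rmorphXn s21.
    by rewrite F01_sqr // cubic_sum_degenerate // legendre_chi // dual_count_degenerate // card_Fp.
  have [-> d1] := deg _ pp1 p12; have [-> d2] := deg _ pp2 p22; split=> //.
    by exists 0; rewrite L1 mulr0 addr0.
  (* The counts are (p - 1)/2, so they differ by half of p1 - p2, a multiple of 8. *)
  by exists ((p1 %/ 8)%N%:Z - (p2 %/ 8)%N%:Z); clear -d1 d2 E16; lia.
have d0 : (s ^+ 2 - 1 != 0) by rewrite subr_eq0.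
have mdiv : (`|s ^+ 2 - 1| %| m)%N by rewrite mE (negPf s21) mulnA dvdn_mull.
have m0 : (0 < m)%N by rewrite mE (negPf s21) !muln_gt0 !absz_gt0 s0 d0.
(* A prime dividing s^2 - 1 divides [m], hence divides any prime congruent to it modulo [m] and
   equals it. *)
have same p q : prime p -> prime q -> p = q %[mod m] -> (p %| s ^+ 2 - 1)%Z -> p = q.
  move=> pp pq Epq pd; have pm : (p %| m)%N by apply: dvdn_trans mdiv.
  apply/eqP; rewrite -dvdn_prime2 // /dvdn -(modn_dvdm q pm) -Epq modn_dvdm //.
  by rewrite modnn.
have refl : p1 = p2 -> [/\ legendre p1 (-1) = legendre p2 (-1),
    exists k : int, F01 p1 (s ^+ 2) = F01 p2 (s ^+ 2) + 16 * k &
    exists k : int, (dual_count (s%:~R : 'F_p1))%:Z = (dual_count (s%:~R : 'F_p2))%:Z + 4 * k].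
  by move=> ->; split=> //; exists 0; rewrite mulr0 addr0.
have [/same e|n1] := boolP (p1 %| s ^+ 2 - 1)%Z; first by apply: refl; apply: e.
have [/same e|n2] := boolP (p2 %| s ^+ 2 - 1)%Z; first by apply/refl/esym/e.
have L a : (a %| s * (s ^+ 2 - 1))%Z -> legendre p1 a = legendre p2 a.
  move=> ad; apply: legendre_periodic => //.
  - apply: contraNN n1 => pa; have := dvdz_trans pa ad.
    by rewrite dvdzE abszM Euclid_dvdM // => /orP[/(negP s1)|].
  - apply: contraNN n2 => pa; have := dvdz_trans pa ad.
    by rewrite dvdzE abszM Euclid_dvdM // => /orP[/(negP s2)|].
  rewrite -(@modn_dvdm m p1) ?E ?modn_dvdm // mE (negPf s21) -abszM;
  by rewrite (dvdn_mul (isT : 4 %| 16)%N).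
have [[k1 F1] D1] := F01_sqr_residues pp1 p12 s1 n1.
have [[k2 F2] D2] := F01_sqr_residues pp2 p22 s2 n2.
have Ls : legendre p1 s = legendre p2 s by apply: L; rewrite dvdz_mulr.
have Lns : legendre p1 (- s) = legendre p2 (- s).
  by apply: L; rewrite dvdzE abszN -dvdzE dvdz_mulr.
have Lp : legendre p1 (s + 1) = legendre p2 (s + 1).
  by apply: L; rewrite subr_sqr_1 mulrA dvdz_mull.
have Lm : legendre p1 (1 - s) = legendre p2 (1 - s).
  by apply: L; rewrite dvdzE distnC -dvdzE subr_sqr_1 dvdz_mull // dvdz_mulr.
have Ld : legendre p1 (s ^+ 2 - 1) = legendre p2 (s ^+ 2 - 1).
  by apply: L; rewrite dvdz_mull.
have Lnd : legendre p1 (1 - s ^+ 2) = legendre p2 (1 - s ^+ 2).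
  by apply: L; rewrite dvdzE distnC -dvdzE dvdz_mull.
rewrite Ls Lns Lp Lm Ld Lnd L1 in F1 D1 D2.
have [t tE] : exists t : int, p1%:Z = p2%:Z + 16 * t.
  by exists ((p1 %/ 16)%N%:Z - (p2 %/ 16)%N%:Z); clear -E16; lia.
have F12 : F01 p1 (s ^+ 2) = F01 p2 (s ^+ 2) + 16 * (k1 - k2 - t).
  by rewrite F1 F2 tE; ring.
split=> //; first by exists (k1 - k2 - t).
rewrite F12 tE in D1; move: D1 D2; clear.
move: (dual_count _) (dual_count _) (F01 _ _) (legendre p2 (_ - 1)) => d1 d2 f c.
(* Four times the count is known modulo 16, hence the count modulo 4. The witnesses match the values
   0, 1, -1 of the symbol of -1. *)
rewrite /legendre; case: ifP => _; first by exists t; lia.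
by case: ifP => _; [exists (k1 - k2) | exists (2 * t - k1 + k2)]; lia.
Qed.


(** * Rational arguments and the product of part (i) *)

Lemma ratmod_frac p (u v : int) : prime p -> ~~ (p %| u)%Z ->
  (ratmod p (v%:Q / u%:Q))%:~R = v%:~R / u%:~R :> 'F_p.
Proof.
move=> pp pu; set x := v%:Q / u%:Q.
have u0 : u%:Q != 0 by rewrite intr_eq0; apply: contraNneq pu => ->; rewrite dvdz0.
have E : numq x * u = v * denq x.
  apply: (@intr_inj rat); rewrite !rmorphM /= numqE /x mulrAC divfK //.
have pd : ~~ (p %| denq x)%Z.
  apply: contraNN pu => pd; have := dvdz_mull v pd.
  rewrite -E !dvdzE abszM Euclid_dvdM // => /orP[pn|//].
  have : (p %| gcdn `|numq x| `|denq x|)%N by rewrite dvdn_gcd pn.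
  by rewrite (eqP (coprime_num_den x)) dvdn1 => /eqP p1; rewrite p1 in pp.
have := ratmodP pp pd; rewrite numq_subz_dvd // -intr_Fp_eq0 // rmorphB rmorphM /= subr_eq0.
rewrite -!intr_Fp_eq0 // in pu pd => /eqP nE.
have := congr1 (fun a : int => a%:~R : 'F_p) E; rewrite !rmorphM /= nE mulrAC => /(mulIf pd) <-.
by rewrite mulfK.
Qed.

(** The value 1 at multiples of p lets the excluded factors back into the product, and makes every
    factor a sign. *)
Definition legendreq1 p (x : rat) : int := if dvdq p x then 1 else legendreq p x.

Lemma legendreq1_sqr p x : legendreq1 p x ^+ 2 = 1.
Proof.
by rewrite /legendreq1 /dvdq /legendreq /legendre; case: (_ \in _) => //; case: ifP.
Qed.

Lemma legendreq1_frac p (u v : int) : prime p -> (2 < p)%N -> ~~ (p %| u)%Z ->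
  legendreq1 p (v%:Q / u%:Q) = if v%:~R == 0 :> 'F_p then 1 else chi (v%:~R / u%:~R : 'F_p).
Proof.
move=> pp p2 pu; rewrite /legendreq1 /dvdq /legendreq legendre_chi // -intr_Fp_eq0 // ratmod_frac //.
by rewrite -intr_Fp_eq0 // in pu; rewrite mulf_eq0 invr_eq0 (negPf pu) orbF.
Qed.

(** For fixed j the involution i -> j - i cancels equal signs in pairs. Only j = 2i survives, and 2j
    < p then reads 4i < p. *)
Lemma prod_symmetric_form (p : nat) (q : nat -> nat -> int) :
    (forall i j, q i j ^+ 2 = 1) ->
    (forall i j, (i < j)%N -> q (j - i)%N j = q i j) ->
  \prod_(i < p) \prod_(j < p | [&& (0 < i)%N, (i < j)%N & (2 * j < p)%N]) q i j =
  \prod_(1 <= i < (p.-1 %/ 4).+1) q i (2 * i)%N.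
Proof.
move=> q2 qC; rewrite (exchange_big_dep predT) //=.
transitivity (\prod_(j < p) \prod_(i < p | [&& (0 < i)%N, (2 * j < p)%N & (2 * i == j)%N]) q i j).
  apply: eq_bigr => j _; pose A (i : 'I_p) := [&& (0 < i)%N, (i < j)%N & (2 * j < p)%N].
  pose h (i : 'I_p) := Ordinal (leq_ltn_trans (leq_subr i j) (ltn_ord j)).
  rewrite (@prod_involution _ A h (fun i => q i j)) //=.
  - by apply: eq_bigl => i; rewrite /A -val_eqE /=; lia.
  - by move=> i; rewrite /A !unfold_in /= => /and3P[i0 ij ->]; rewrite andbT; lia.
  - by move=> i /and3P[i0 ij _]; apply: val_inj; rewrite /= subKn // ltnW.
  - by move=> i /and3P[i0 ij _]; apply: qC.
rewrite (exchange_big_dep predT) //=.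
transitivity (\prod_(i < p | (0 < i)%N && (4 * i < p)%N) q i (2 * i)%N).
  rewrite [RHS]big_mkcond; apply: eq_bigr => i _; case: ifP => [|ip].
    move=> ip; have jp : (2 * i < p)%N by lia.
    rewrite (big_pred1 (Ordinal jp)) // => j /=; rewrite -val_eqE /=; lia.
  by rewrite big_pred0 // => j; lia.
rewrite -(big_mkord (fun i => (0 < i) && (4 * i < p))%N (fun i => q i (2 * i)%N)).
case: p => [|p]; first by rewrite !big_geq.
rewrite (@big_nat_widenl _ _ _ 1 0) // [RHS](@big_nat_widen _ _ _ 0 _ p.+1) /=; last by lia.
by apply: eq_bigl => i; lia.
Qed.

Theorem theorem3p3 :
  (forall (p : nat) (u v : int) (t : rat),
     prime p -> (3 < p)%N -> ~~ (p %| u)%Z -> t = v%:Q / u%:Q ->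
     let q (i j : nat) : rat := i%:Q ^+ 2 - i%:Q * j%:Q + t * j%:Q ^+ 2 in
     \prod_(i < p) \prod_(j < p | [&& (0 < i)%N, (i < j)%N, (2 * j < p)%N
                                    & ~~ dvdq p (q i j)])
        legendreq p (q i j)
     = if ((p %% 8 == 5)%N || (p %% 8 == 7)%N)
          && (legendreq p (4 * t - 1) == -1)
       then -1 else 1)
  /\
  (forall s : int, s != 0 ->
     let D (p : nat) := [&& prime p, (3 < p)%N & ~~ (p %| s)%Z] in
     let q (i j : nat) : int := s ^+ 2 * i%:Z ^+ 2 - j%:Z ^+ 2 in
     periodic_on D (fun p => (F01 p (s ^+ 2) %% 16)%Z)
     /\
     periodic_on D (fun p =>
       \prod_(i < p) \prod_(j < p | [&& (0 < i)%N, (i < j)%N, (2 * j < p)%N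
                                      & ~~ (p %| q i j)%Z])
          legendre p (q i j))).
Proof.
split.
  move=> p u v t pp p3 pu tE q; have p2 := ltnW p3; have oF := odd_card_Fp pp p2.
  have u0 : u%:Q != 0 by rewrite intr_eq0; apply: contraNneq pu => ->; rewrite dvdz0.
  transitivity (\prod_(i < p) \prod_(j < p | [&& (0 < i)%N, (i < j)%N & (2 * j < p)%N])
      legendreq1 p (q i j)).
    apply: eq_bigr => i _; rewrite big_mkcond [RHS]big_mkcond; apply: eq_bigr => j _.
    rewrite /legendreq1; case: (dvdq _ _); first by rewrite !andbF; case: ifP.
    by rewrite andbT.
  rewrite (@prod_symmetric_form _ (fun i j => legendreq1 p (q i j))); last first.
  - move=> i j ij; congr legendreq1; rewrite /q -subzn 1?ltnW // rmorphB /=; ring.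
  - by move=> i j; apply: legendreq1_sqr.
  have tQ : 4 * t - 1 = (4 * v - u)%:Q / u%:Q by rewrite tE rmorphB rmorphM /=; field.
  have qE i : (0 < i)%N -> (i < p)%N -> legendreq1 p (q i (2 * i)%N) = legendreq1 p (4 * t - 1).
    move=> i0 ip; have iF : (i%:R : 'F_p) != 0.
      by rewrite -(dvdn_pcharf (pchar_Fp pp)) gtnNdvd.
    have -> : q i (2 * i)%N = ((4 * v - u) * i%:Z ^+ 2)%:Q / u%:Q.
      by rewrite /q tE PoszM !rmorphM rmorphB !rmorphM /=; field.
    rewrite tQ !legendreq1_frac // rmorphM rmorphXn /= mulf_eq0 expf_eq0 /= (negPf iF) orbF.
    by rewrite mulrAC chiMX2.
  rewrite big_nat_cond (eq_bigr (fun=> legendreq1 p (4 * t - 1))) => [|i]; last first.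
    by rewrite andbT => ip; apply: qE; lia.
  rewrite -big_nat_cond prodr_const_nat subSS subn0.
  (* The number of surviving factors is floor((p - 1)/4), odd precisely for these odd classes modulo
     8. *)
  have -> : (p %% 8 == 5)%N || (p %% 8 == 7)%N = odd (p.-1 %/ 4).
    by move: oF; rewrite card_Fp //; lia.
  (* When p divides 4t - 1 the symbol is 0 rather than -1, in agreement with the value 1 on the
     left. *)
  have -> : legendreq1 p (4 * t - 1) = (-1) ^+ (legendreq p (4 * t - 1) == -1).
    rewrite /legendreq1 /dvdq /legendreq /legendre.
    by case: ifP => pr /=; rewrite ?pr //=; case: ifP.
  by rewrite -exprM -signr_odd oddM oddb andbC; case: (_ && _).
move=> s s0 D q; pose m := (16 * (`|s| * (if s ^+ 2 == 1 then 1 else `|s ^+ 2 - 1|)))%N.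
have m0 : (0 < m)%N.
  rewrite !muln_gt0 absz_gt0 s0 /=; case: eqP => // /eqP; rewrite absz_gt0 subr_eq0 //.
split; exists m => // p1 p2 /and3P[pp1 p13 s1] /and3P[pp2 p23 s2] E;
  have [L [k F] [l dE]] := periodicity_transfer s0 (erefl m) pp1 p13 s1 pp2 p23 s2 E.
  by rewrite F; lia.
have [p12 p22] := (ltnW p13, ltnW p23).
rewrite !prod_legendre_Fp //.
have [N1 [k1 [-> E1]]] := prod_half_pairs pp1 p12 (s%:~R).
have [N2 [k2 [-> E2]]] := prod_half_pairs pp2 p22 (s%:~R).
have LE n : prime n -> (2 < n)%N -> legendre n (-1) = chi (-1 : 'F_n).
  by move=> pn n2; rewrite legendre_chi // rmorphN1.
move: E1 E2; rewrite -!LE // L => E1 E2.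
rewrite -signr_odd -[in RHS]signr_odd; congr (_ ^+ nat_of_bool _).
(* The dual counts agree modulo 4 and the corrections at -1 agree, so 2 N1 and 2 N2 agree modulo
   4. *)
move: (dual_count _) (dual_count _) dE E1 E2 => d1 d2 dE; case: (_ == _);
  by clear -dE; lia.
Qed.
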